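(* Let $G = (V,E)$ be a distance regular graph with $n = \operatorname{diam} G$. Let $\theta_0 > \theta_1 > \cdots > \theta_n$ be the distinct eigenvalues of its adjacency matrix $A_1$, and let $v_i$ ($0 \le i \le n$) be the univariate polynomial of degree $i$ with $A_i = v_i(A_1)$, where $A_i$ is the $i$-th adjacency (distance-$i$) matrix of $G$. Then \[ c_2(G)^2 \;\geq\; \frac{n^2\, v_n(\theta_0)}{v_1(\theta_0)} \; \min_{j \in \{1,\ldots,n\}} \left\{ \frac{v_1(\theta_0) - v_1(\theta_j)}{v_n(\theta_0) - v_n(\theta_j)} \right\}. \]
   Context: Graphs are finite and undirected: $G=(V,E)$ with $V$ a finite vertex set and $E \subseteq \binom{V}{2}$ a set of two-element subsets of $V$. For $x,y\in V$, $d(x,y)$ is the length of a shortest path between $x$ and $y$ ($\infty$ if there is none), and $\operatorname{diam} G = \max_{x,y\in V} d(x,y)$. $G$ is connected if its diameter is finite; then $(V,d)$ is a finite metric space. Distortion: for a finite metric space $(X,d)$ with $N$ elements, an embedding $\varrho : X \to \mathbb{R}^N$ (Euclidean norm $\|\cdot\|$) has distortion $D$ if $d(x,y) \le \|\varrho(x)-\varrho(y)\| \le D\, d(x,y)$ for all $x,y\in X$. The least distortion $c_2(X,d)$ is the least $D$ for which such an embedding exists. For a connected graph $G$ with shortest path metric $d$, $c_2(G) := c_2(V,d)$. A connected graph $G$ is distance regular if there are constants $a_i,b_i,c_i$ ($0\le i\le \operatorname{diam} G$) such that for all $x,y \in V$ with $d(x,y)=i$: $a_i = |\{z\in V : d(x,z)=1,\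 d(z,y)=i\}|$, $b_i = |\{z\in V : d(x,z)=1,\ d(z,y)=i+1\}|$, $c_i = |\{z\in V : d(x,z)=1,\ d(z,y)=i-1\}|$. The $i$-th adjacency matrix $A_i\in\{0,1\}^{V\times V}$ has $(A_i)_{xy}=1$ if $d(x,y)=i$ and $0$ otherwise. For a distance regular graph the relation $A_1A_i = c_{i+1}A_{i+1}+a_iA_i+b_{i-1}A_{i-1}$ holds, so $A_i = v_i(A_1)$ for a univariate polynomial $v_i$ of degree $i$; $A_1$ has exactly $\operatorname{diam} G + 1$ distinct eigenvalues. *)

(* Defs.v *)
From mathcomp Require Import all_boot all_order all_algebra.
From mathcomp Require Import classical_sets reals constructive_ereal.

Set Implicit Arguments.
Unset Strict Implicit.
Unset Printing Implicit Defensive.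

Import Order.TTheory GRing.Theory Num.Theory.
Local Open Scope ring_scope.

Section Graph.
Variables (V : finType) (E : {set {set V}}).

Definition simple_edges : Prop := forall f, f \in E -> #|f| = 2%N.

Definition adj : rel V := [rel x y | [set x; y] \in E].

Definition connected_graph : Prop := forall x y : V, connect adj x y.

(* A shortest path has at most #|V|.-1 edges, so the bound on k loses nothing.
   The infinite distance between vertices joined by no path is encoded as #|V|;
   it does not occur in a connected graph. *)
Definition gdist (x y : V) : nat :=
  \big[minn/#|V|]_(k < #|V| |
     [exists p : k.-tuple V, path adj x p && (last x p == y)]) k.

Definition diam : nat := \max_(x : V) \max_(y : V) gdist x y.

(* The condition on c is stated with a successor, so that for i = 0 it is
   satisfied by no z, like d(z, y) = -1. *)
Definition distance_regular : Prop :=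
  connected_graph /\
  exists a b c : nat -> nat, forall i, (i <= diam)%N ->
    forall x y : V, gdist x y = i ->
      [/\ a i = #|[set z | (gdist x z == 1%N) && (gdist z y == i)]|,
          b i = #|[set z | (gdist x z == 1%N) && (gdist z y == i.+1)]|
        & c i = #|[set z | (gdist x z == 1%N) && ((gdist z y).+1 == i)]|].

(* V x V matrices are indexed by ordinals through the enumeration of V. *)
Definition adjmx (R : nzRingType) (i : nat) : 'M[R]_#|V| :=
  \matrix_(x, y) (gdist (enum_val x) (enum_val y) == i)%:R.

End Graph.

(* [horner_mx] is only available for matrices whose size is a successor, which
   #|V| is not syntactically; [eval_mxE] shows that this is the same notion. *)
Definition eval_mx (R : comNzRingType) (m : nat) (p : {poly R}) (A : 'M[R]_m) :
  'M[R]_m := \sum_(k < size p) p`_k *: A ^+ k.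

Lemma eval_mxE (R : comNzRingType) (m : nat) (p : {poly R}) (A : 'M[R]_m.+1) :
  eval_mx p A = horner_mx A p.
Proof.
rewrite -[p in RHS]coefK poly_def linear_sum; apply: eq_bigr => k _.
by rewrite linearZ /= rmorphXn /= horner_mx_X.
Qed.

(* The library norm on row vectors is the sup norm, hence this one. *)
Definition enorm (R : realType) (m : nat) (u : 'rV[R]_m) : R :=
  Num.sqrt (\sum_i u ord0 i ^+ 2).

Definition has_distortion (R : realType) (X : finType) (d : X -> X -> R)
    (rho : X -> 'rV[R]_#|X|) (D : R) : Prop :=
  forall x y, d x y <= enorm (rho x - rho y) /\
              enorm (rho x - rho y) <= D * d x y.

(* For a finite metric space with at least two points the set is nonempty and
   bounded below by 1, and by compactness its infimum is a minimum. *)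
Definition c2 (R : realType) (X : finType) (d : X -> X -> R) : R :=
  inf [set D : R | exists rho, has_distortion d rho D]%classic.

Definition c2_graph (R : realType) (V : finType) (E : {set {set V}}) : R :=
  c2 (fun x y : V => (gdist E x y)%:R : R).

(* Main.v *)
(* Compare the quadratic forms of two Laplacians. For c the minimum in the
   statement, theta_0 - A_1 - c (v_n(theta_0) - A_n) is a polynomial in the
   symmetric matrix A_1 that is nonnegative at every theta_j, hence positive
   semidefinite. Evaluated on each coordinate of an embedding rho of distortion D
   and summed over the coordinates, this bounds c times the sum of
   |rho x - rho y|^2 over the pairs at distance n by the same sum over the
   adjacent pairs. Every vertex has theta_0 neighbours and v_n(theta_0) vertices
   at distance n, so the former sum is at least |V| v_n(theta_0) n^2 and the
   latter at most |V| theta_0 D^2. *)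
Require Import Defs.
From mathcomp Require Import all_boot all_order all_algebra.
From mathcomp Require Import classical_sets reals constructive_ereal.
From mathcomp.real_closed Require complex.

Import Order.TTheory GRing.Theory Num.Theory.
Local Open Scope ring_scope.

(** * Polynomials evaluated at a matrix *)

Lemma eval_mxB (F : comNzRingType) (m : nat) (A : 'M[F]_m) (p q : {poly F}) :
  eval_mx (p - q) A = eval_mx p A - eval_mx q A.
Proof.
case: m A => [|m] A; first by apply/matrixP => -[].
by rewrite !eval_mxE linearB.
Qed.

Lemma eval_mxZ (F : comNzRingType) (m : nat) (A : 'M[F]_m) (c : F)
    (p : {poly F}) :
  eval_mx (c *: p) A = c *: eval_mx p A.
Proof.
case: m A => [|m] A; first by apply/matrixP => -[].
by rewrite !eval_mxE linearZ.
Qed.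

Lemma eval_mxC (F : comNzRingType) (m : nat) (A : 'M[F]_m) (c : F) :
  eval_mx c%:P A = c%:M.
Proof.
case: m A => [|m] A; first by apply/matrixP => -[].
by rewrite eval_mxE horner_mx_C.
Qed.

Lemma eval_mxX (F : comNzRingType) (m : nat) (A : 'M[F]_m) :
  eval_mx 'X A = A.
Proof.
case: m A => [|m] A; first by apply/matrixP => -[].
by rewrite eval_mxE horner_mx_X.
Qed.

Lemma map_eval_mx (F L : comNzRingType) (f : {rmorphism F -> L}) (m : nat)
    (A : 'M[F]_m) (p : {poly F}) :
  map_mx f (eval_mx p A) = eval_mx (map_poly f p) (map_mx f A).
Proof.
case: m A => [|m] A; first by apply/matrixP => -[].
by rewrite !eval_mxE map_horner_mx.
Qed.

Lemma eval_mx_eigen (F : comNzRingType) (m : nat) (A : 'M[F]_m) (p : {poly F})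
    (u : 'rV[F]_m) (a : F) :
  u *m A = a *: u -> u *m eval_mx p A = p.[a] *: u.
Proof.
move=> uA; rewrite /eval_mx mulmx_sumr horner_coef scaler_suml.
apply: eq_bigr => k _; rewrite -scalemxAr -scalerA; congr (_ *: _).
elim: {k}(k : nat) => [|k IHk]; first by rewrite !expr0 mulmx1 scale1r.
by rewrite exprS [A * _]/(A *m _) mulmxA uA -scalemxAl IHk scalerA -exprS.
Qed.

(** * Positive semidefinite polynomials in a symmetric matrix *)

Section Spectral.
Import complex.

(** Over [R[i]] the matrix is Hermitian, so an orthonormal eigenbasis diagonalizes both [A] and
    [eval_mx q A]. There the form is the sum of [q.[d_i] |w_i|^2], with every [d_i] a real
    eigenvalue of [A]. *)
Lemma sym_eval_mx_ge0 (R : rcfType) (m : nat) (A : 'M[R]_m) (q : {poly R})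
    (u : 'rV[R]_m) :
  A^T = A -> (forall a, eigenvalue A a -> 0 <= q.[a]) ->
  0 <= (u *m eval_mx q A *m u^T) 0 0.
Proof.
move=> symA q_ge0; pose f := real_complex R.
pose B := map_mx f A; pose P := spectralmx B; pose d := spectral_diag B.
have hB : B \is hermsymmx.
  apply: realsym_hermsym; last first.
    by apply/mxOverP => i j; rewrite mxE complex_real.
  by apply/is_hermitianmxP; rewrite expr0 scale1r map_mx_id// /B map_trmx symA.
have uP : P \is unitarymx := spectral_unitarymx B.
have PB : P *m B = diag_mx d *m P.
  have /hermitian_normalmx/orthomx_spectralP := hB.
  rewrite -/P -/d => {1}->.
  by rewrite !mulmxA mulmxV ?unitarymx_unit// mul1mx.
have rowP i : row i P *m B = d 0 i *: row i P.
  by rewrite -row_mul PB row_mul row_diag_mx -scalemxAl -rowE.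
have Pn0 i : row i P != 0.
  apply/negP => /eqP Pi0; have /row_unitarymxP/(_ i i) := uP.
  by rewrite Pi0 linear0l eqxx => /eqP; rewrite eq_sym oner_eq0.
(* An informative existential, because the real eigenvalue [s2val (dE i)] is used below to build a
   diagonal matrix. *)
have dE i : {r : R | d 0 i = f r & 0 <= q.[r]}.
  have /mxOverP/(_ 0 i)/complex_realP/sig_eqW := hermitian_spectral_diag_real hB.
  case=> r dr; exists r => //; apply: q_ge0.
  rewrite -(eigenvalue_map f) -/B; apply/eigenvalueP.
  by exists (row i P); rewrite // rowP dr.
pose M := map_mx f (eval_mx q A).
have PM : P *m M = diag_mx (\row_i f q.[s2val (dE i)]) *m P.
  apply/row_matrixP => i; rewrite row_mul /M map_eval_mx.
  rewrite (eval_mx_eigen _ _ _ _ _ _ (rowP i)) row_mul row_diag_mx.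
  rewrite -scalemxAl -rowE mxE.
  by case: (dE i) => r /= -> _; rewrite horner_map.
(* The coordinates of [u] in the eigenbasis formed by the rows of [P]. *)
pose w := map_mx f u *m P^t*%sesqui.
have wE : map_mx f (u *m eval_mx q A *m u^T) =
    w *m diag_mx (\row_i f q.[s2val (dE i)]) *m w^t*%sesqui.
  rewrite !map_mxM -/M /w -[M]mul1mx.
  have -> : 1%:M = P^t*%sesqui *m P.
    by rewrite -invmx_unitary// mulVmx// unitarymx_unit.
  rewrite -(mulmxA _ P) PM -!mulmxA; do 3 congr (_ *m _).
  rewrite trmx_mul map_mxM trmxCK; congr (_ *m _).
  apply/matrixP => i j; rewrite !mxE; apply/esym/CrealP.
  by rewrite complex_real.
have : 0 <= f ((u *m eval_mx q A *m u^T) 0 0).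
  have -> : f ((u *m eval_mx q A *m u^T) 0 0) =
            (map_mx f (u *m eval_mx q A *m u^T)) 0 0 by rewrite [RHS]mxE.
  rewrite wE mxE sumr_ge0// => i _.
  rewrite mul_mx_diag !mxE mulrAC mulr_ge0 ?mul_conjC_ge0//.
  by case: (dE i) => r /= _; rewrite ler0c.
by rewrite ler0c.
Qed.

End Spectral.

(** * Row sums and Laplacian quadratic forms *)

(** Compare l1 norms: by the triangle inequality, right multiplication by [B] enlarges the l1 norm
    of a row vector at most [k] times. *)
Lemma eigenvalue_le_rowsum (R : realFieldType) (m : nat) (B : 'M[R]_m)
    (k a : R) (u : 'rV[R]_m) :
  (forall i j, 0 <= B i j) -> (forall i, \sum_j B i j = k) ->
  u != 0 -> u *m B = a *: u -> `|a| <= k.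
Proof.
move=> B_ge0 rowB u_neq0 uB.
have u_gt0 : 0 < \sum_j `|u 0 j|.
  have [j uj] := rV0Pn _ u_neq0.
  by rewrite (bigD1 j)//= ltr_wpDr ?sumr_ge0// normr_gt0.
rewrite -(ler_pM2r u_gt0) !mulr_sumr.
have -> : \sum_i k * `|u 0 i| = \sum_j \sum_i `|u 0 i| * B i j.
  by rewrite exchange_big; apply: eq_bigr => i _; rewrite -mulr_sumr rowB mulrC.
apply: ler_sum => j _; rewrite -normrM.
have -> : a * u 0 j = (u *m B) 0 j by rewrite uB mxE.
rewrite mxE (le_trans (ler_norm_sum _ _ _))//.
by apply: ler_sum => i _; rewrite normrM (ger0_norm (B_ge0 _ _)).
Qed.

(** Expand the square: by symmetry both square terms sum to [k] times the sum of the [f_i^2]. The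
    factor 2 arises because ordered pairs are summed. *)
Lemma laplacian_form (R : comNzRingType) (m : nat) (B : 'M[R]_m) (k : R)
    (f : 'rV[R]_m) :
  B^T = B -> (forall i, \sum_j B i j = k) ->
  \sum_i \sum_j B i j * (f 0 i - f 0 j) ^+ 2 =
  (f *m (k%:M - B) *m f^T) 0 0 *+ 2.
Proof.
move=> symB rowB.
have symBE i j : B i j = B j i by rewrite -{1}symB mxE.
have diagE : \sum_i \sum_j B i j * f 0 i ^+ 2 = k * \sum_i f 0 i ^+ 2.
  by rewrite mulr_sumr; apply: eq_bigr => i _; rewrite -mulr_suml rowB.
have formE : (f *m (k%:M - B) *m f^T) 0 0 =
    k * (\sum_i f 0 i ^+ 2) - \sum_i \sum_j B i j * (f 0 i * f 0 j).
  rewrite mulmxBr mulmxBl mul_mx_scalar -scalemxAl mxE; congr (_ + _).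
    rewrite mxE; congr (_ * _); rewrite mxE.
    by apply: eq_bigr => i _; rewrite mxE expr2.
  rewrite mxE; congr (- _); rewrite mxE exchange_big; apply: eq_bigr => j _.
  by rewrite !mxE mulr_suml; apply: eq_bigr => i _; rewrite mulrAC mulrC.
rewrite formE mulrnBl mulr2n -{1}diagE -diagE [X in _ + X - _]exchange_big /=.
rewrite -sumrMnl -!(big_split, sumrN) /=; apply: eq_bigr => i _.
rewrite -sumrMnl -!(big_split, sumrN) /=; apply: eq_bigr => j _.
by rewrite sqrrB (symBE j i) mulrDr mulrDr mulrN mulrnAr addrAC.
Qed.

(** * The graph distance as a metric *)

Section GraphDistance.
Variables (V : finType) (E : {set {set V}}).

Lemma gdistC x y : gdist E x y = gdist E y x.
Proof.
apply: eq_bigl => k; wlog suff sub : x y /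
  [exists p : k.-tuple V, path (adj E) x p && (last x p == y)] ->
  [exists p : k.-tuple V, path (adj E) y p && (last y p == x)].
  by apply/idP/idP; apply: sub.
case/existsP => p /andP[xp /eqP py]; apply/existsP.
exists [tuple of rev (belast x p)]; apply/andP; split => /=.
  rewrite -py rev_path -(eq_path (e := adj E))// => u w.
  by rewrite /adj /= finset.setUC.
by rewrite -py; case: (tval p) => //= z s; rewrite rev_cons last_rcons.
Qed.

Lemma gdist_gt0 x y : x != y -> (0 < gdist E x y)%N.
Proof.
move=> neq_xy; have V_gt0 : (0 < #|V|)%N by apply/card_gt0P; exists x.
apply: (big_ind (fun k => 0 < k)%N) => // [i j i0 j0|[[|k] lt_k] //=].
  by rewrite leq_min i0.
by case/existsP => p; rewrite tuple0 /= (negPf neq_xy).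
Qed.

Lemma gdistxx x : gdist E x x = 0%N.
Proof.
have V_gt0 : (0 < #|V|)%N by apply/card_gt0P; exists x.
apply/eqP; rewrite -leqn0.
apply: (@bigmin_le_cond _ nat _ _ (Ordinal V_gt0) _ (fun k => nat_of_ord k)).
by apply/existsP; exists [tuple]; rewrite /= eqxx.
Qed.

Lemma gdist_diam x y : (gdist E x y <= diam E)%N.
Proof. by apply: leq_trans (leq_bigmax x); exact: (leq_bigmax y). Qed.

Lemma diam_attained : (0 < #|V|)%N -> exists x y, gdist E x y = diam E.
Proof.
move=> V_gt0; rewrite /diam.
have [x ->] := @bigop.eq_bigmax _ (fun x => \max_y gdist E x y) V_gt0.
by have [y ->] := @bigop.eq_bigmax _ (gdist E x) V_gt0; exists x, y.
Qed.

Lemma tr_adjmx (R : nzRingType) i : (adjmx E R i)^T = adjmx E R i.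
Proof. by apply/matrixP => x y; rewrite !mxE gdistC. Qed.

End GraphDistance.

(** * Euclidean embeddings and their distortion *)

Lemma sqr_enorm (R : realType) (m : nat) (u : 'rV[R]_m) :
  enorm u ^+ 2 = \sum_i u 0 i ^+ 2.
Proof. by rewrite sqr_sqrtr// sumr_ge0// => i _; rewrite sqr_ge0. Qed.

(** Send the points to the vertices of a regular simplex of side [N * sqrt 2]. This side exceeds
    every distance, and is at most itself times any distance between distinct points, these being at
    least 1. *)
Lemma has_distortion_ex (R : realType) (X : finType) (d : X -> X -> R) (N : R) :
  (forall x, d x x = 0) -> (forall x y, x != y -> 1 <= d x y <= N) -> 0 <= N ->
  exists (rho : X -> 'rV[R]_#|X|) (D : R), has_distortion d rho D.
Proof.
move=> dxx d_bnd N_ge0.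
exists (fun x => N *: delta_mx 0 (enum_rank x)), (N * Num.sqrt 2) => x y.
have [<-|neq_xy] := eqVneq x y.
  rewrite dxx mulr0 subrr /enorm big1 ?sqrtr0// => i _.
  by rewrite mxE expr0n.
have /andP[d_ge1 d_leN] := d_bnd _ _ neq_xy.
have -> : enorm (N *: delta_mx 0 (enum_rank x) -
    N *: delta_mx 0 (enum_rank y) : 'rV[R]_#|X|) = N * Num.sqrt 2.
  rewrite /enorm -[N in RHS]ger0_norm// -sqrtr_sqr -sqrtrM ?sqr_ge0//.
  congr Num.sqrt; set ex := enum_rank x; set ey := enum_rank y.
  have neq_e : ex != ey by rewrite (inj_eq enum_rank_inj).
  transitivity (\sum_i N ^+ 2 * ((i == ex)%:R + (i == ey)%:R)).
    apply: eq_bigr => i _; rewrite !mxE /= -mulrBr exprMn; congr (_ * _).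
    have [->|_] := eqVneq i ex; first by rewrite (negPf neq_e) subr0 addr0 expr1n.
    by case: (i == ey); rewrite ?sub0r ?subr0 ?sqrrN ?expr1n ?expr0n add0r.
  rewrite -mulr_sumr big_split -!natr_sum.
  have cardE (e : 'I_#|X|) : (\sum_i (i == e) = 1)%N.
    by rewrite (bigD1 e)//= eqxx big1// => i /negPf->.
  by rewrite !cardE.
have s2 : 1 <= Num.sqrt 2 :> R by rewrite -[leLHS]sqrtr1 ler_sqrt ?ler1n.
split; first by rewrite (le_trans d_leN)// ler_peMr.
by rewrite ler_peMr// mulr_ge0// sqrtr_ge0.
Qed.

(** Squared norms split over coordinates, so real-valued [f] suffices. Then [laplacian_form] turns
    the difference of the two sides into twice the form of [q(A)], where [gap] says that [q] is
    nonnegative on the spectrum. *)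
Lemma spectral_gap_ineq (R : realType) (m d : nat) (A B : 'M[R]_m)
    (p : {poly R}) (k c : R) (f : 'I_m -> 'rV[R]_d) :
  A^T = A -> B^T = B -> B = eval_mx p A ->
  (forall i, \sum_j A i j = k) -> (forall i, \sum_j B i j = p.[k]) ->
  (forall a, eigenvalue A a -> c * (p.[k] - p.[a]) <= k - a) ->
  c * (\sum_i \sum_j B i j * enorm (f i - f j) ^+ 2) <=
  \sum_i \sum_j A i j * enorm (f i - f j) ^+ 2.
Proof.
move=> symA symB defB rowA rowB gap.
have split_coord (M : 'M[R]_m) :
    \sum_i \sum_j M i j * enorm (f i - f j) ^+ 2 =
    \sum_l \sum_i \sum_j M i j *
      ((\row_h f h 0 l) 0 i - (\row_h f h 0 l) 0 j) ^+ 2.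
  rewrite [RHS]exchange_big; apply: eq_bigr => i _.
  rewrite [RHS]exchange_big; apply: eq_bigr => j _.
  rewrite sqr_enorm mulr_sumr; apply: eq_bigr => l _.
  by rewrite !mxE.
rewrite !split_coord mulr_sumr; apply: ler_sum => l _.
rewrite (laplacian_form _ _ _ _ _ symA rowA).
rewrite (laplacian_form _ _ _ _ _ symB rowB).
set u := \row_h _; rewrite mulrnAr lerMn2r /= -subr_ge0.
pose q := (k%:P - 'X) - c *: (p.[k]%:P - p).
have : 0 <= (u *m eval_mx q A *m u^T) 0 0.
  apply: sym_eval_mx_ge0 => // a /gap; rewrite -subr_ge0.
  by rewrite !hornerE.
rewrite /q !(eval_mxB, eval_mxZ, eval_mxC, eval_mxX) -defB.
rewrite mulmxBr mulmxBl -scalemxAr -scalemxAl.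
have subE (M N : 'M[R]_1) : (M - N) 0 0 = M 0 0 - N 0 0 by rewrite !mxE.
have scaleE (M : 'M[R]_1) : (c *: M) 0 0 = c * M 0 0 by rewrite mxE.
by rewrite subE scaleE.
Qed.

(** * Valencies and the bound for a single embedding *)

Section Valency.
Variables (V : finType) (E : {set {set V}}).

Lemma sum_adjmx (R : nzRingType) i (x : 'I_#|V|) :
  \sum_y adjmx E R i x y = #|[set z | gdist E (enum_val x) z == i]|%:R.
Proof.
under eq_bigr do rewrite mxE.
rewrite -natr_sum -sum1_card [in RHS]big_mkcond /=; congr _%:R.
rewrite [RHS](reindex _ (onW_bij _ (@enum_val_bij V))) /=.
by apply: eq_bigr => y _; rewrite inE; case: eqP.
Qed.

Lemma distance_regular_valency : distance_regular E ->
  exists k, forall x, #|[set z | gdist E x z == 1%N]| = k.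
Proof.
(* With [i = 0] and [y = x], both conditions counted by [b 0] say that [z] is at distance 1 from
   [x]. *)
case=> _ [a] [b] [c] abc; exists (b 0%N) => x.
have [_ -> _] := abc 0%N (leq0n _) x x (gdistxx V E x).
by apply: eq_card => z; rewrite !inE (gdistC V E z) andbb.
Qed.

(** The all-ones vector is an eigenvector of [A_1] for [k], hence of [p(A_1)] for [p.[k]]; by
    symmetry its image lists the row sums. *)
Lemma sum_adjmx_poly (R : comNzRingType) i (p : {poly R}) (k : R) :
  (forall x, \sum_y adjmx E R 1 x y = k) ->
  adjmx E R i = eval_mx p (adjmx E R 1) ->
  forall x, \sum_y adjmx E R i x y = p.[k].
Proof.
move=> row1 defAi x.
have mul_ones j y : (const_mx 1 *m adjmx E R j : 'rV_#|V|) 0 y =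
    \sum_z adjmx E R j y z.
  rewrite mxE; apply: eq_bigr => z _.
  by rewrite mxE mul1r -{1}tr_adjmx mxE.
have /eval_mx_eigen : const_mx 1 *m adjmx E R 1 = k *: const_mx 1 :> 'rV_#|V|.
  by apply/rowP => y; rewrite mul_ones row1 !mxE mulr1.
move=> /(_ p)/rowP/(_ x).
by rewrite -defAi mul_ones => ->; rewrite !mxE mulr1.
Qed.

Lemma distortion_ge (R : realType) (p : {poly R}) (k c D : R)
    (rho : V -> 'rV[R]_#|V|) :
  (0 < #|V|)%N ->
  (forall x, \sum_y adjmx E R 1 x y = k) ->
  adjmx E R (diam E) = eval_mx p (adjmx E R 1) ->
  0 <= c ->
  (forall a, eigenvalue (adjmx E R 1) a -> c * (p.[k] - p.[a]) <= k - a) ->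
  has_distortion (fun x y => (gdist E x y)%:R) rho D ->
  c * ((diam E)%:R ^+ 2 * p.[k]) <= D ^+ 2 * k.
Proof.
move=> V_gt0 row1 defAn c_ge0 gap dist_rho.
have rown := sum_adjmx_poly _ _ _ _ row1 defAn.
have := spectral_gap_ineq _ _ _ _ _ _ _ _ (fun x => rho (enum_val x))
  (tr_adjmx _ _ _ _) (tr_adjmx _ _ _ _) defAn row1 rown gap.
have VR_gt0 : 0 < #|V|%:R :> R by rewrite ltr0n.
have sum_const (g : 'M[R]_#|V|) (s t : R) : (forall x, \sum_y g x y = s) ->
    \sum_x \sum_y g x y * t = #|V|%:R * (t * s).
  move=> row_g; under eq_bigr do rewrite -mulr_suml row_g mulrC.
  by rewrite sumr_const card_ord mulr_natl.
move=> ineq; rewrite -(ler_pM2l VR_gt0) mulrCA.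
rewrite -(sum_const _ _ _ rown) -(sum_const _ _ _ row1).
apply: le_trans (le_trans ineq _).
  apply: ler_wpM2l => //; apply: ler_sum => x _; apply: ler_sum => y _.
  rewrite mxE; case: eqP => [d_xy|_]; rewrite ?mul0r// !mul1r.
  have [ge_d _] := dist_rho (enum_val x) (enum_val y).
  by rewrite -d_xy ler_sqr// nnegrE// sqrtr_ge0.
apply: ler_sum => x _; apply: ler_sum => y _.
rewrite mxE; case: eqP => [d_xy|_]; rewrite ?mul0r// !mul1r.
have [_] := dist_rho (enum_val x) (enum_val y); rewrite d_xy mulr1 => le_D.
(* Squaring requires [0 <= D], which follows here from [0 <= enorm _ <= D] on an adjacent pair. *)
have en_ge0 := sqrtr_ge0 (\sum_i (rho (enum_val x) - rho (enum_val y)) 0 i ^+ 2).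
by rewrite ler_sqr// nnegrE//; apply: le_trans le_D.
Qed.

End Valency.

(** * The infimum over embeddings and the minimum over eigenvalues *)

(** The infimum of an empty set is 0 by default, so a lower bound passes to [c2_graph] only once
    some embedding of finite distortion is exhibited. *)
Lemma c2_graph_ge (R : realType) (V : finType) (E : {set {set V}}) (s : R) :
  (forall D rho, has_distortion (fun x y => (gdist E x y)%:R : R) rho D ->
    s <= D) -> s <= c2_graph R E.
Proof.
move=> lb; apply: lb_le_inf; last by move=> D [rho]; apply: lb.
have [x|x y neq_xy||rho [D rhoD]] := has_distortion_ex R V
  (fun x y => (gdist E x y)%:R) (diam E)%:R; last by exists D, rho.
- by rewrite gdistxx.
- by rewrite ler1n gdist_gt0// ler_nat gdist_diam.
- by [].
Qed.

(** The index [j0] keeps the minimum below [+oo]. Where [b j = 0], the last inequality reduces to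
    [0 <= a j], whatever the quotient is. *)
Lemma bigmin_ratioP (R : realType) (n j0 : nat) (a b : nat -> R) :
  (forall j, (1 <= j <= n)%N -> 0 <= a j) ->
  (forall j, (1 <= j <= n)%N -> 0 <= b j) ->
  (1 <= j0 <= n)%N -> b j0 != 0 ->
  exists c : R, [/\ 0 <= c,
    (\big[Order.min/+oo]_(1 <= j < n.+1) ((a j)%:E / (b j)%:E) = c%:E)%E
    & forall j, (1 <= j <= n)%N -> c * b j <= a j].
Proof.
move=> a_ge0 b_ge0 j0n bj0; set S := (\big[_/_]_(_ <= _ < _) _)%E.
have S_ge0 : (0 <= S)%E.
  rewrite /S big_nat_cond; apply: le_bigmin; first exact: leey.
  move=> j /andP[j_n _].
  by rewrite mule_ge0// ?inve_ge0 lee_fin ?a_ge0 ?b_ge0.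
have S_le j : (1 <= j <= n)%N -> (S <= (a j)%:E / (b j)%:E)%E.
  by move=> j_n; apply: ge_bigmin_seq; rewrite ?mem_index_iota.
have : (S < +oo)%E.
  apply: le_lt_trans (S_le _ j0n) _.
  by rewrite inver (negPf bj0) -EFinM ltry.
case: S S_ge0 S_le => [c| |]//; rewrite lee_fin => c_ge0 S_le _.
exists c; split=> // j j_n; have [->|bj_neq0] := eqVneq (b j) 0.
  by rewrite mulr0 a_ge0.
have bj_gt0 : 0 < b j by rewrite lt_def bj_neq0 b_ge0.
by have := S_le j j_n; rewrite inver (negPf bj_neq0) -EFinM lee_fin ler_pdivlMr.
Qed.
(* Extended reals: r%:E^-1 is +oo for r = 0, so that an index j with
   v_n(theta_0) = v_n(theta_j) (such j exist, e.g. for hypercubes) contributes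
   (v_1(theta_0) - v_1(theta_j)) / 0 = +oo to the minimum. *)
Theorem theorem2p4 (R : realType) (V : finType) (E : {set {set V}}) (n : nat)
    (theta : nat -> R) (v : nat -> {poly R})
    (simpleE : simple_edges E)
    (drE : distance_regular E)
    (diamE : n = diam E)
    (theta_decr : forall i j : nat, (i < j <= n)%N -> theta j < theta i)
    (theta_eig : forall a : R,
       eigenvalue (adjmx E R 1) a <-> exists2 i : nat, (i <= n)%N & a = theta i)
    (v_size : forall i : nat, (i <= n)%N -> size (v i) = i.+1)
    (v_adj : forall i : nat, (i <= n)%N ->
       adjmx E R i = eval_mx (v i) (adjmx E R 1)) :
  ((n%:R ^+ 2 * (v n).[theta 0%N] / (v 1%N).[theta 0%N])%:E *
     \big[Order.min/+oo]_(1 <= j < n.+1)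
       (((v 1%N).[theta 0%N] - (v 1%N).[theta j])%:E /
        ((v n).[theta 0%N] - (v n).[theta j])%:E)
   <= (c2_graph R E ^+ 2)%:E)%E.
Proof.
have V_gt0 : (0 < #|V|)%N.
  have /theta_eig/eigenvalueP[u _] : exists2 i, (i <= n)%N & theta 0 = theta i.
    by exists 0%N.
  rewrite lt0n; apply: contraNneq => V0; apply/eqP/rowP => i.
  by have := ltn_ord i; rewrite [X in (_ < X)%N]V0 ltn0.
(* For [n = 0] the empty minimum is [+oo], but its coefficient is 0 and [0 * +oo = 0]. *)
have [n0|n_gt0] := posnP n.
  by rewrite n0 expr0n /= !mul0r mul0e lee_fin sqr_ge0.
have [val valP] := distance_regular_valency _ _ drE.
pose k : R := val%:R.
have row1 x : \sum_y adjmx E R 1 x y = k by rewrite sum_adjmx valP.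
have rowi i (i_n : (i <= n)%N) := sum_adjmx_poly _ _ _ _ _ _ row1 (v_adj i i_n).
have adj_ge0 i x y : 0 <= adjmx E R i x y by rewrite mxE ler0n.
have theta_ex j : (j <= n)%N ->
    exists2 u : 'rV_#|V|, u *m adjmx E R 1 = theta j *: u & u != 0.
  by move=> j_n; apply/eigenvalueP/theta_eig; exists j.
(* [v_i(theta_j)] is an eigenvalue of the nonnegative matrix [A_i], whose row sums are [v_i(k)]. *)
have v_bound i j : (i <= n)%N -> (j <= n)%N -> `|(v i).[theta j]| <= (v i).[k].
  move=> i_n /theta_ex[u uA u_neq0].
  apply: (eigenvalue_le_rowsum _ _ _ _ _ _ (adj_ge0 i) (rowi _ i_n) u_neq0).
  by rewrite v_adj//; apply: eval_mx_eigen.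
(* Apply [A_1 = v_1(A_1)] to an eigenvector for [theta_j]. *)
have v1 j : (j <= n)%N -> (v 1%N).[theta j] = theta j.
  move=> /theta_ex[u uA /rV0Pn[x ux]].
  have := eval_mx_eigen _ _ _ (v 1%N) _ _ uA; rewrite -v_adj// uA.
  by move=> /rowP/(_ x); rewrite !mxE => /(mulIf ux).
have theta_le j : (j <= n)%N -> theta j <= theta 0%N.
  by case: j => // j j_n; rewrite ltW// theta_decr.
have v1k : (v 1%N).[k] = k.
  by rewrite -(rowi 1%N n_gt0 (Ordinal V_gt0)) row1.
(* The row sum [k] bounds every eigenvalue and is itself one, with the all-ones eigenvector. *)
have kE : k = theta 0%N.
  apply/le_anti/andP; split; last first.
    apply: le_trans (ler_norm _) _.
    by rewrite -[theta 0%N]v1// -v1k v_bound.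
  have /theta_eig[j j_n ->] : eigenvalue (adjmx E R 1) k.
    apply/eigenvalueP; exists (const_mx 1).
      apply/rowP => y; rewrite !mxE mulr1 -(row1 y).
      by apply: eq_bigr => z _; rewrite mxE mul1r -[in LHS]tr_adjmx mxE.
    by apply/rV0Pn; exists (Ordinal V_gt0); rewrite mxE oner_eq0.
  exact: theta_le.
(* If [k] were 0, then [|theta_1| <= k] would force [theta_1 = 0 = k], against
   [theta_1 < theta_0 = k]. *)
have k_gt0 : 0 < k.
  have lt_k : theta 1%N < k by rewrite kE theta_decr.
  have := v_bound 1%N 1%N n_gt0 n_gt0; rewrite v1// v1k => th1.
  rewrite lt_def ler0n andbT; apply: contraTneq lt_k => k0.
  by move: th1; rewrite k0 normr_le0 => /eqP->; rewrite ltxx.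
have vn_gt0 : 0 < (v n).[k].
  have [x [y d_xy]] := diam_attained _ E V_gt0.
  rewrite -(rowi n (leqnn n) (enum_rank x)) sum_adjmx enum_rankK ltr0n.
  by apply/card_gt0P; exists y; rewrite inE d_xy diamE.
rewrite v1// -kE; pose p := v n - (v n).[k]%:P.
(* The polynomial [p] has degree [n], so it cannot vanish at all [n + 1] distinct eigenvalues; since
   it vanishes at [theta_0 = k], the index found is positive. *)
have [j0 j0_n vj0] : exists2 j, (1 <= j <= n)%N &
    (v n).[k] - (v n).[theta j] != 0.
  have size_p : size p = n.+1.
    rewrite size_polyDl v_size// size_polyN.
    by rewrite (leq_ltn_trans (size_polyC_leq1 _)).
  have uniq_th : uniq (map theta (iota 0 n.+1)).
    rewrite map_inj_in_uniq ?iota_uniq// => i j.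
    rewrite !mem_iota !add0n !ltnS /= => i_n j_n th_ij.
    case: (ltngtP i j) => // lt_ij.
      by have := theta_decr i j; rewrite lt_ij j_n th_ij ltxx => /(_ isT).
    by have := theta_decr j i; rewrite lt_ij i_n th_ij ltxx => /(_ isT).
  have p_neq0 : p != 0 by rewrite -size_poly_eq0 size_p.
  have : ~~ all (root p) (map theta (iota 0 n.+1)).
    apply/negP => p_th; have := max_poly_roots p_neq0 p_th uniq_th.
    by rewrite size_p size_map size_iota ltnn.
  rewrite all_map => /allPn[j]; rewrite mem_iota /= add0n ltnS => j_n.
  rewrite /root /p !hornerE => vj; exists j; last by rewrite -oppr_eq0 opprB.
  rewrite j_n andbT lt0n; apply: contraNneq vj => ->.
  by rewrite -kE subrr.
have [j j_n|j /andP[_ j_n]|c [c_ge0 -> c_gap]] := bigmin_ratioP _ n j0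
  (fun j => k - (v 1%N).[theta j]) (fun j => (v n).[k] - (v n).[theta j])
  _ _ j0_n vj0.
- by case/andP: j_n => _ j_n; rewrite v1// kE subr_ge0 theta_le.
- by rewrite subr_ge0 (le_trans (ler_norm _))// v_bound.
rewrite -EFinM lee_fin; set s := _ * c.
have s_ge0 : 0 <= s by rewrite !mulr_ge0 ?invr_ge0 ?sqr_ge0 ?(ltW vn_gt0)// ltW.
have gap a : eigenvalue (adjmx E R 1) a -> c * ((v n).[k] - (v n).[a]) <= k - a.
  move=> /theta_eig[[|j] j_n ->]; first by rewrite -kE !subrr mulr0.
  by have := c_gap j.+1 j_n; rewrite v1.
(* Taking the root makes the bound linear in [D], so that it passes to the infimum; it also yields
   [0 <= c2_graph R E], needed to square back. *)
suff le_c2 : Num.sqrt s <= c2_graph R E.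
  rewrite -[s]sqr_sqrtr// ler_sqr// nnegrE ?sqrtr_ge0//.
  exact: le_trans (sqrtr_ge0 s) le_c2.
apply: c2_graph_ge => D rho rhoD.
(* A pair at distance [n] gives [n <= D * n] with [n > 0]. *)
have D_ge0 : 0 <= D.
  have [x [y d_xy]] := diam_attained _ E V_gt0.
  have [/le_trans le_D /le_D] := rhoD x y; rewrite d_xy -diamE => le_nD.
  have nR_gt0 : 0 < n%:R :> R by rewrite ltr0n.
  by rewrite -(pmulr_lge0 _ nR_gt0) (le_trans _ le_nD)// ltW.
rewrite -[D]ger0_norm// -sqrtr_sqr ler_sqrt ?sqr_ge0// /s.
have := v_adj n (leqnn n); rewrite {1}diamE => defAn.
rewrite mulrAC ler_pdivrMr// [_ * c]mulrC.
have := distortion_ge _ _ _ _ _ _ _ _ V_gt0 row1 defAn c_ge0 gap rhoD.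
by rewrite -diamE.
Qed.
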